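(* Let $\mathfrak{g}$ be a perfect Lie algebra over a field $\mathbb{K}$ (i.e. $\mathfrak{g}=[\mathfrak{g},\mathfrak{g}]$). Then there is an exact sequence $$0\to HL_2\big(\mathfrak{g}\underset{Lie}{\star}\mathfrak{g}\big)\to HL_2(\mathfrak{g})\overset{t_{\mathfrak{g}}}{\longrightarrow}H_2(\mathfrak{g})\to0,$$ where $\mathfrak{g}\underset{Lie}{\star}\mathfrak{g}$ is the non-abelian tensor square of the Lie algebra $\mathfrak{g}$ and $t_{\mathfrak{g}}$ is the natural epimorphism from second Leibniz homology to second Chevalley–Eilenberg homology.
   Context: $\mathbb{K}$ is a field, $\otimes=\otimes_{\mathbb{K}}$. A Lie algebra is regarded as a Leibniz algebra, i.e. a vector space with bilinear bracket satisfying $[x,[y,z]]=[[x,y],z]-[[x,z],y]$. For a Leibniz algebra $\mathfrak{g}$, $HL_n(\mathfrak{g})$ is the $n$-th homology of the complex with $CL_n(\mathfrak{g})=\mathfrak{g}^{\otimes n}$, $d(x)=0$ for $x\in\mathfrak{g}$, and for $n>1$ $$d(x_1\otimes\cdots\otimes x_n)=\sum_{1\le i<j\le n}(-1)^j\, x_1\otimes\cdots\otimes x_{i-1}\otimes[x_i,x_j]\otimes x_{i+1}\otimes\cdots\otimes\widehat{x_j}\otimes\cdots\otimes x_n .$$ For a Lie algebra, $H_n(\mathfrak{g})$ is the Chevalley–Eilenberg homology with trivial coefficients, the homology of the complex $\Lambda^n\mathfrak{g}$ with the boundary given by the same formula with $\otimes$ replaced by $\wedge$; $t_{\mathfrak{g}}\colon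 HL_2(\mathfrak{g})\to H_2(\mathfrak{g})$ is induced by the canonical projections $\mathfrak{g}^{\otimes n}\to\Lambda^n\mathfrak{g}$. The non-abelian tensor square (Ellis) $\mathfrak{g}\underset{Lie}{\star}\mathfrak{g}$ of a Lie algebra $\mathfrak{g}$ is the Lie algebra generated by symbols $x*y$ ($x,y\in\mathfrak{g}$), $\mathbb{K}$-bilinear in $x$ and $y$, subject to $[x,x']*y=x*[x',y]-x'*[x,y]$, $x*[y,y']=[y',x]*y-[y,x]*y'$, and $[x*y,x'*y']=-[y,x]*[x',y']$ for all $x,x',y,y'\in\mathfrak{g}$. *)

(* Defs.v *)
From HB Require Import structures.
From mathcomp Require Import all_boot all_order all_algebra.
From mathcomp Require Import generic_quotient boolp.
From mathcomp Require Import freeg zify.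

Set Implicit Arguments.
Unset Strict Implicit.
Unset Printing Implicit Defensive.

Import GRing.Theory.
Local Open Scope ring_scope.
Local Open Scope quotient_scope.

Reserved Notation "[lie x , y ]" (format "[lie  x ,  y ]").

HB.mixin Record Lmodule_isLeibniz (K : fieldType) L of GRing.Lmodule K L := {
  lie_bracket : L -> L -> L;
  lie_linearl : forall (a : K) (x y z : L),
    lie_bracket (a *: x + y) z = a *: lie_bracket x z + lie_bracket y z;
  lie_linearr : forall (a : K) (x y z : L),
    lie_bracket x (a *: y + z) = a *: lie_bracket x y + lie_bracket x z;
  leibniz_identity : forall x y z : L,
    lie_bracket x (lie_bracket y z)
    = lie_bracket (lie_bracket x y) z - lie_bracket (lie_bracket x z) y
}.

#[short(type="leibnizAlgType")]
HB.structure Definition Leibniz (K : fieldType) :=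
  {L of Lmodule_isLeibniz K L & GRing.Lmodule K L}.

(* For an alternating bracket the Leibniz identity is the Jacobi identity,
   see [lie_jacobi]. *)
HB.mixin Record Leibniz_isLie (K : fieldType) L of Leibniz K L := {
  lie_alt : forall x : L, lie_bracket x x = 0
}.

#[short(type="lieAlgType")]
HB.structure Definition Lie (K : fieldType) :=
  {L of Leibniz_isLie K L & Leibniz K L}.

Notation "[lie x , y ]" := (lie_bracket x y) : ring_scope.

Lemma lie_anti (K : fieldType) (g : lieAlgType K) (x y : g) :
  [lie x, y] = - [lie y, x].
Proof.
have H := lie_alt (x + y).
have e1 z : [lie x + y, z] = [lie x, z] + [lie y, z].
  by have := lie_linearl 1 x y z; rewrite !scale1r.
have e2 z : [lie z, x + y] = [lie z, x] + [lie z, y].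
  by have := lie_linearr 1 z x y; rewrite !scale1r.
move: H; rewrite e1 !e2 !lie_alt add0r addr0 => /eqP.
by rewrite addr_eq0 => /eqP.
Qed.

Lemma lie0r (K : fieldType) (g : leibnizAlgType K) (x : g) : [lie x, 0] = 0.
Proof.
by have := lie_linearr (-1) x 0 0; rewrite scaler0 addr0 scaleN1r addNr.
Qed.

Lemma lieNr (K : fieldType) (g : leibnizAlgType K) (x y : g) :
  [lie x, - y] = - [lie x, y].
Proof.
by have := lie_linearr (-1) x y 0; rewrite lie0r !addr0 !scaleN1r.
Qed.

Lemma lie_jacobi (K : fieldType) (g : lieAlgType K) (x y z : g) :
  [lie x, [lie y, z]] + [lie y, [lie z, x]] + [lie z, [lie x, y]] = 0.
Proof.
rewrite leibniz_identity (lie_anti z [lie x, y]) (lie_anti [lie x, z] y).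
by rewrite (lie_anti z x) lieNr opprK [X in X + _]addrAC subrK addrN.
Qed.

Inductive lspan (K : fieldType) (V : lmodType K) (S : V -> Prop) : V -> Prop :=
| lspan_gen v : S v -> lspan S v
| lspan0 : lspan S 0
| lspanP (a : K) u v : lspan S u -> lspan S v -> lspan S (a *: u + v).

Section Quotient.
Variables (K : fieldType) (V : lmodType K) (S : V -> Prop).

Lemma lspanZ a u : lspan S u -> lspan S (a *: u).
Proof. by move=> Su; rewrite -[_ *: _]addr0; apply/lspanP/lspan0. Qed.
Lemma lspanD u v : lspan S u -> lspan S v -> lspan S (u + v).
Proof. by move=> Su Sv; rewrite -[u]scale1r; apply: lspanP. Qed.
Lemma lspanN u : lspan S u -> lspan S (- u).
Proof. by move=> Su; rewrite -scaleN1r; apply: lspanZ. Qed.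

Definition lquot_eqv (x y : V) : bool := `[< lspan S (x - y) >].

Lemma lquot_eqv_refl : reflexive lquot_eqv.
Proof. by move=> x; apply/asboolP; rewrite subrr; apply: lspan0. Qed.
Lemma lquot_eqv_sym : symmetric lquot_eqv.
Proof.
by move=> x y; apply/asboolP/asboolP => /lspanN; rewrite opprB.
Qed.
Lemma lquot_eqv_trans : transitive lquot_eqv.
Proof.
move=> y x z /asboolP xy /asboolP yz; apply/asboolP.
by rewrite -(subrK y x) -addrA; apply: lspanD.
Qed.

Canonical lquot_eqv_equiv :=
  EquivRel lquot_eqv lquot_eqv_refl lquot_eqv_sym lquot_eqv_trans.

Definition lquot : Type := {eq_quot lquot_eqv}.
HB.instance Definition _ := Choice.on lquot.
HB.instance Definition _ := Quotient.on lquot.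

Definition lquot_pi (v : V) : lquot := \pi_lquot v.

Lemma lquot_piP x y : lquot_pi x = lquot_pi y <-> lspan S (x - y).
Proof.
have E : (lquot_pi x == lquot_pi y) = lquot_eqv x y.
  exact: (eqmodE lquot_eqv_equiv).
by split=> [/eqP|xy]; [rewrite E => /asboolP | apply/eqP; rewrite E; apply/asboolP].
Qed.

Lemma lquot_reprK q : lquot_pi (repr q) = q.
Proof. exact: (@reprK _ lquot). Qed.

Lemma lquot_repr v : lspan S (repr (lquot_pi v) - v).
Proof. by apply/lquot_piP; rewrite lquot_reprK. Qed.

Definition lquot_zero : lquot := lquot_pi 0.
Definition lquot_opp (p : lquot) : lquot := lquot_pi (- repr p).
Definition lquot_add (p q : lquot) : lquot := lquot_pi (repr p + repr q).
Definition lquot_scale (a : K) (p : lquot) : lquot := lquot_pi (a *: repr p).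

Lemma lquot_oppE x : lquot_opp (lquot_pi x) = lquot_pi (- x).
Proof. by apply/lquot_piP; rewrite -opprD; apply/lspanN/lquot_repr. Qed.
Lemma lquot_addE x y :
  lquot_add (lquot_pi x) (lquot_pi y) = lquot_pi (x + y).
Proof. by apply/lquot_piP; rewrite opprD addrACA; apply/lspanD; apply/lquot_repr. Qed.
Lemma lquot_scaleE a x : lquot_scale a (lquot_pi x) = lquot_pi (a *: x).
Proof. by apply/lquot_piP; rewrite -scalerBr; apply/lspanZ/lquot_repr. Qed.

Lemma lquot_addA : associative lquot_add.
Proof.
move=> p q r; rewrite -(lquot_reprK p) -(lquot_reprK q) -(lquot_reprK r).
by rewrite !lquot_addE addrA.
Qed.
Lemma lquot_addC : commutative lquot_add.
Proof. by move=> p q; rewrite /lquot_add addrC. Qed.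
Lemma lquot_add0 : left_id lquot_zero lquot_add.
Proof. by move=> p; rewrite -(lquot_reprK p) lquot_addE add0r. Qed.
Lemma lquot_addN : left_inverse lquot_zero lquot_opp lquot_add.
Proof. by move=> p; rewrite -(lquot_reprK p) lquot_oppE lquot_addE addNr. Qed.

HB.instance Definition _ := GRing.isZmodule.Build lquot
  lquot_addA lquot_addC lquot_add0 lquot_addN.

Lemma lquot_piD x y : lquot_pi (x + y) = lquot_pi x + lquot_pi y.
Proof. by rewrite -lquot_addE. Qed.

Lemma lquot_scaleA a b p :
  lquot_scale a (lquot_scale b p) = lquot_scale (a * b) p.
Proof. by rewrite -(lquot_reprK p) !lquot_scaleE scalerA. Qed.
Lemma lquot_scale1 : left_id 1 lquot_scale.
Proof. by move=> p; rewrite -(lquot_reprK p) lquot_scaleE scale1r. Qed.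
Lemma lquot_scaleDr : right_distributive lquot_scale +%R.
Proof.
move=> a p q; rewrite -(lquot_reprK p) -(lquot_reprK q).
by rewrite -lquot_piD !lquot_scaleE -lquot_piD scalerDr.
Qed.
Lemma lquot_scaleDl p : {morph lquot_scale^~ p : a b / a + b}.
Proof.
by move=> a b; rewrite -(lquot_reprK p) !lquot_scaleE -lquot_piD scalerDl.
Qed.

HB.instance Definition _ := GRing.Zmodule_isLmodule.Build K lquot
  lquot_scaleA lquot_scale1 lquot_scaleDr lquot_scaleDl.

Lemma lquot_pi_linear : linear lquot_pi.
Proof. by move=> a x y; rewrite lquot_piD -lquot_scaleE. Qed.
HB.instance Definition _ := GRing.isLinear.Build K V lquot _ lquot_pi
  lquot_pi_linear.

Lemma lquot_pi_eq0 x : lquot_pi x = 0 <-> lspan S x.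
Proof. by rewrite -[X in lspan S X]subr0 -lquot_piP linear0. Qed.

Lemma lspan_vanish (W : lmodType K) (f : {linear V -> W}) :
  (forall v, S v -> f v = 0) -> forall v, lspan S v -> f v = 0.
Proof.
move=> fS v; elim=> [u /fS//||a u w _ fu _ fw]; first exact: linear0.
by rewrite linearP fu fw scaler0 addr0.
Qed.

Section Lift.
Variables (W : lmodType K) (f : {linear V -> W}).

Definition lquot_lift (fS : forall v, S v -> f v = 0) (q : lquot) : W :=
  f (repr q).

Hypothesis fS : forall v, S v -> f v = 0.

Lemma lquot_liftE v : lquot_lift fS (lquot_pi v) = f v.
Proof.
apply/eqP; rewrite -subr_eq0 -linearB; apply/eqP.
exact: (lspan_vanish fS) (lquot_repr v).
Qed.

Lemma lquot_lift_linear : linear (lquot_lift fS).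
Proof.
move=> a p q; rewrite -(lquot_reprK p) -(lquot_reprK q).
by rewrite -linearP !lquot_liftE linearP.
Qed.
HB.instance Definition _ := GRing.isLinear.Build K lquot W _ (lquot_lift fS)
  lquot_lift_linear.
End Lift.
End Quotient.

Section Homology.
Variables (K : fieldType) (A B C : lmodType K).
Variables (d1 : {linear A -> B}) (d0 : {linear B -> C}).

Definition ker_pred : {pred B} := fun x => d0 x == 0.
Lemma ker_submod_closed : submod_closed ker_pred.
Proof.
split=> [|a x y]; rewrite !unfold_in ?linear0 // linearP.
by move=> /eqP-> /eqP->; rewrite scaler0 addr0.
Qed.
HB.instance Definition _ :=
  GRing.isSubmodClosed.Build K B ker_pred ker_submod_closed.

Definition cycles := {x : B | x \in ker_pred}.
HB.instance Definition _ := Choice.on cycles.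
HB.instance Definition _ := SubType.on cycles.
HB.instance Definition _ := [SubChoice_isSubLmodule of cycles by <:].

(* Ker d0 / (Ker d0 and Im d1); this is Ker d0 / Im d1 when d0 o d1 = 0 *)
Definition homology := lquot (fun z : cycles => exists a : A, val z = d1 a).
HB.instance Definition _ := GRing.Lmodule.on homology.
End Homology.

Section HomologyMap.
Variables (K : fieldType) (A B C A' B' C' : lmodType K).
Variables (d1 : {linear A -> B}) (d0 : {linear B -> C}).
Variables (d1' : {linear A' -> B'}) (d0' : {linear B' -> C'}).
Variables (fA : {linear A -> A'}) (fB : {linear B -> B'}).
Variables (fC : {linear C -> C'}).
Hypothesis comm1 : forall a, fB (d1 a) = d1' (fA a).
Hypothesis comm0 : forall b, fC (d0 b) = d0' (fB b).

Lemma cycles_map_subproof (z : cycles d0) : fB (val z) \in ker_pred d0'.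
Proof.
by rewrite unfold_in -comm0; have /eqP -> := valP z; rewrite linear0.
Qed.
Definition cycles_map (z : cycles d0) : cycles d0' :=
  Sub (fB (val z)) (cycles_map_subproof z).

Definition cycles_class_map (z : cycles d0) : homology d1' d0' :=
  lquot_pi _ (cycles_map z).
Lemma cycles_class_map_linear : linear cycles_class_map.
Proof.
move=> a x y; rewrite /cycles_class_map -linearP; congr (lquot_pi _ _).
by apply: val_inj; rewrite /= !linearP.
Qed.
HB.instance Definition _ := GRing.isLinear.Build K (cycles d0)
  (homology d1' d0') _ cycles_class_map cycles_class_map_linear.

Lemma cycles_class_map_boundary (z : cycles d0) :
  (exists a, val z = d1 a) -> cycles_class_map z = 0.
Proof.
by case=> a za; apply/lquot_pi_eq0/lspan_gen; exists (fA a); rewrite /= za comm1.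
Qed.

Definition homology_map : {linear homology d1 d0 -> homology d1' d0'} :=
  lquot_lift cycles_class_map_boundary.
End HomologyMap.

Section FreeLift.
Variables (K : fieldType) (T : choiceType) (W : lmodType K) (f : T -> W).

Lemma fglift_additive : zmod_morphism (fglift f : {freeg T / K} -> W).
Proof. exact: lift_is_additive. Qed.
HB.instance Definition _ := GRing.isZmodMorphism.Build {freeg T / K} W
  (fglift f) fglift_additive.

Lemma fglift_scalable : scalable (fglift f : {freeg T / K} -> W).
Proof.
move=> c D; rewrite -{2}[D]freeg_sumE raddf_sum [in RHS]raddf_sum /= scaler_sumr.
by apply: eq_bigr => x _; rewrite !liftU scalerA.
Qed.
HB.instance Definition _ := GRing.isScalable.Build K {freeg T / K} W _
  (fglift f) fglift_scalable.

Lemma fglift1 x : fglift f << x >> = f x.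
Proof. by rewrite liftU scale1r. Qed.
End FreeLift.

Section Powers.
Variables (K : fieldType) (V : lmodType K).

Definition upd n (x : {ffun 'I_n -> V}) (i : 'I_n) (u : V) :
    {ffun 'I_n -> V} :=
  [ffun k => if k == i then u else x k].

Definition tens_rel n (t : {freeg {ffun 'I_n -> V} / K}) : Prop :=
  exists x i (a : K) u v,
    t = << upd x i (a *: u + v) >> - a *: << upd x i u >> - << upd x i v >>.

Definition tpower n := lquot (@tens_rel n).
HB.instance Definition _ n := GRing.Lmodule.on (tpower n).

(* x_0 (x) ... (x) x_(n-1) *)
Definition tens n (x : {ffun 'I_n -> V}) : tpower n := lquot_pi _ << x >>.

Definition ext_rel n (t : tpower n) : Prop :=
  exists (x : {ffun 'I_n -> V}) i j, [/\ i != j, x i = x j & t = tens x].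

Definition epower n := lquot (@ext_rel n).
HB.instance Definition _ n := GRing.Lmodule.on (epower n).

Definition tens_ext n : {linear tpower n -> epower n} := lquot_pi (@ext_rel n).

Lemma upd_id n (x : {ffun 'I_n -> V}) i : upd x i (x i) = x.
Proof. by apply/ffunP => k; rewrite ffunE; case: eqP => // ->. Qed.

Lemma tens_updP n (x : {ffun 'I_n -> V}) i a u v :
  tens (upd x i (a *: u + v)) = a *: tens (upd x i u) + tens (upd x i v).
Proof.
have : tens_rel (<< upd x i (a *: u + v) >> - a *: << upd x i u >>
                 - << upd x i v >>) by exists x, i, a, u, v.
move/lspan_gen/lquot_pi_eq0; rewrite !linearB linearZ /= -addrA -opprD.
by move/eqP; rewrite subr_eq0 => /eqP.
Qed.

Lemma tens_upd0 n (x : {ffun 'I_n -> V}) i : tens (upd x i 0) = 0.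
Proof.
by have := tens_updP x i (-1) 0 0; rewrite scaler0 addr0 scaleN1r addNr.
Qed.

Lemma tens_ext_eq0 n (x : {ffun 'I_n -> V}) i j :
  i != j -> x i = x j -> tens_ext n (tens x) = 0.
Proof. by move=> ij xij; apply/lquot_pi_eq0/lspan_gen; exists x, i, j. Qed.

Section Multilinear.
Variables (n : nat) (W : lmodType K) (f : {ffun 'I_n -> V} -> W).
Hypothesis f_multilinear : forall x i a u v,
  f (upd x i (a *: u + v)) = a *: f (upd x i u) + f (upd x i v).

Lemma tens_lift_subproof t : tens_rel t -> fglift f t = 0.
Proof.
case=> x [i [a [u [v ->]]]].
by rewrite !linearB linearZ /= !fglift1 f_multilinear addrAC addrK subrr.
Qed.

Definition tens_lift : {linear tpower n -> W} := lquot_lift tens_lift_subproof.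

Lemma tens_liftE x : tens_lift (tens x) = f x.
Proof. exact: etrans (lquot_liftE tens_lift_subproof _) (fglift1 f x). Qed.

Lemma multilinear_swap (x : {ffun 'I_n -> V}) (i j : 'I_n) u v : i != j ->
  (forall y : {ffun 'I_n -> V}, y i = y j -> f y = 0) ->
  f (upd (upd x i u) j v) = - f (upd (upd x i v) j u).
Proof.
move=> ij f0; apply/eqP; rewrite -addr_eq0; apply/eqP.
have updC y z : upd (upd x i y) j z = upd (upd x j z) i y.
  apply/ffunP => k; rewrite !ffunE; case: eqP => [->|//].
  by rewrite eq_sym (negbTE ij).
have fD y k c d : f (upd y k (c + d)) = f (upd y k c) + f (upd y k d).
  by have := f_multilinear y k 1 c d; rewrite !scale1r.
have z w : f (upd (upd x i w) j w) = 0.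
  by apply: f0; rewrite !ffunE !eqxx (negbTE ij).
have := z (u + v); rewrite fD updC fD [in X in _ + X]updC fD -!updC.
by rewrite !z add0r addr0 addrC.
Qed.

Lemma multilinear_alt :
  (forall (x : {ffun 'I_n -> V}) (a b : 'I_n),
     b = a.+1 :> nat -> x a = x b -> f x = 0) ->
  forall (x : {ffun 'I_n -> V}) (i j : 'I_n), i != j -> x i = x j -> f x = 0.
Proof.
move=> f_adj.
suff H d (x : {ffun 'I_n -> V}) (i j : 'I_n) :
    j = (i + d).+1%N :> nat -> x i = x j -> f x = 0.
  move=> x i j; rewrite neq_ltn => /orP[] /= ij xij.
    by apply: (H (j - i.+1)%N x i j) => //; lia.
  by apply: (H (i - j.+1)%N x j i) => //; lia.
elim: d x i j => [|d IH] x i j jE xij; first by apply: f_adj xij; lia.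
have kP : (i + d.+1 < n)%N by have := ltn_ord j; lia.
pose k := Ordinal kP.
have kj : k != j by apply/eqP => /(congr1 val) /=; lia.
have ik : i != k by apply/eqP => /(congr1 val) /=; lia.
have ij : i != j by apply/eqP => /(congr1 val) /=; lia.
have -> : x = upd (upd x k (x k)) j (x j) by rewrite !upd_id.
rewrite multilinear_swap //; last by move=> y; apply: f_adj; rewrite /= jE; lia.
rewrite (IH _ i k) ?oppr0 //=; first by lia.
by rewrite !ffunE eqxx (negbTE ij) (negbTE ik) (negbTE kj).
Qed.
End Multilinear.

Lemma tens_ext_multilinear n (x : {ffun 'I_n -> V}) i a u v :
  tens_ext n (tens (upd x i (a *: u + v)))
  = a *: tens_ext n (tens (upd x i u)) + tens_ext n (tens (upd x i v)).
Proof. by rewrite tens_updP linearP. Qed.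

Lemma tens_ext_swap n (x : {ffun 'I_n -> V}) i j u v : i != j ->
  tens_ext n (tens (upd (upd x i u) j v))
  = - tens_ext n (tens (upd (upd x i v) j u)).
Proof.
move=> ij.
apply: (multilinear_swap (f := fun y => tens_ext n (tens y)))=> //.
  exact: tens_ext_multilinear.
by move=> y; apply: tens_ext_eq0.
Qed.
End Powers.

Section LeibnizComplex.
Variables (K : fieldType) (g : leibnizAlgType K).

(* replace x_i by [x_i, x_j] and delete x_j *)
Definition face n (i j : 'I_n) (x : {ffun 'I_n -> g}) : {ffun 'I_n.-1 -> g} :=
  [ffun k => upd x i [lie x i, x j] (fintype.lift j k)].

(* Indices start at 0 here, whence the sign (-1)^(j+1). *)
Definition leibniz_bd n (x : {ffun 'I_n -> g}) : tpower g n.-1 :=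
  \sum_(i < n) \sum_(j < n | (i < j)%N) (-1) ^+ j.+1 *: tens (face i j x).

Lemma face_upd n (i j k : 'I_n) (x : {ffun 'I_n -> g}) : i != j ->
  exists y m (phi : g -> g),
    (forall a u v, phi (a *: u + v) = a *: phi u + phi v) /\
    (forall u, face i j (upd x k u) = upd y m (phi u)).
Proof.
move=> ij; have ji : j != i by rewrite eq_sym.
have [m im _] := unlift_some ji.
have Em l : (fintype.lift j l == i) = (l == m).
  by rewrite im (inj_eq lift_inj).
have Ej l : (fintype.lift j l == j) = false.
  by rewrite eq_sym (negbTE (neq_lift _ _)).
have [->|kj] := eqVneq k j.
  exists (face i j x), m, (fun u => [lie x i, u]).
  split=> [a u v|u]; first by rewrite lie_linearr.
  by apply/ffunP => l; rewrite !ffunE Em Ej eqxx (negbTE ij); case: eqP.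
have [->|ki] := eqVneq k i.
  exists (face i j x), m, (fun u => [lie u, x j]).
  split=> [a u v|u]; first by rewrite lie_linearl.
  by apply/ffunP => l; rewrite !ffunE Em eqxx (negbTE ji); case: (l == m).
have jk : j != k by rewrite eq_sym.
have [p kp _] := unlift_some jk.
have Ep l : (fintype.lift j l == k) = (l == p).
  by rewrite kp (inj_eq lift_inj).
exists (face i j x), p, id; split=> // u.
apply/ffunP => l; rewrite !ffunE Em Ep.
rewrite [i == k]eq_sym (negbTE ki) (negbTE jk).
case: (eqVneq l p) => [->|//]; case: eqP => // pm.
by move: ki; rewrite kp im pm eqxx.
Qed.

Lemma leibniz_bd_multilinear n (x : {ffun 'I_n -> g}) k a u v :
  leibniz_bd (upd x k (a *: u + v))
  = a *: leibniz_bd (upd x k u) + leibniz_bd (upd x k v).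
Proof.
rewrite /leibniz_bd scaler_sumr -big_split; apply: eq_bigr => i _ /=.
rewrite scaler_sumr -big_split; apply: eq_bigr => j ij /=.
have [|y [m [phi [phiP E]]]] := @face_upd n i j k x.
  by rewrite neq_ltn ij.
by rewrite !E phiP tens_updP scalerDr !scalerA mulrC.
Qed.

Definition CL n : lmodType K := tpower g n.

Definition leibniz_d n : {linear CL n -> CL n.-1} :=
  tens_lift (@leibniz_bd_multilinear n).

Lemma leibniz_dE n (x : {ffun 'I_n -> g}) :
  leibniz_d n (tens x) = leibniz_bd x.
Proof. exact: tens_liftE. Qed.

Definition HL n : lmodType K := homology (leibniz_d n.+1) (leibniz_d n).
End LeibnizComplex.

Section LieComplex.
Variables (K : fieldType) (g : lieAlgType K).

Definition CE n : lmodType K := epower g n.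
Definition CL_CE n : {linear CL g n -> CE n} := tens_ext g n.

Lemma ce_bd_adjacent n (x : {ffun 'I_n -> g}) (a b : 'I_n) :
  b = a.+1 :> nat -> x a = x b -> CL_CE n.-1 (leibniz_bd x) = 0.
Proof.
move=> ba xab.
have ab : a != b by apply/eqP => /(congr1 val) /=; rewrite ba; lia.
pose F (i j : 'I_n) := CL_CE n.-1 ((-1) ^+ j.+1 *: tens (face i j x)).
have -> : CL_CE n.-1 (leibniz_bd x) = \sum_(i < n) \sum_(j < n | (i < j)%N) F i j.
  by rewrite linear_sum; apply: eq_bigr => i _; rewrite linear_sum.
(* the two equal entries survive *)
have F0 i j : i != j -> i != a -> i != b -> j != a -> j != b -> F i j = 0.
  move=> ij ia ib ja jb; rewrite /F linearZ /=.
  have [p ap _] := unlift_some ja; have [q bq _] := unlift_some jb.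
  rewrite (@tens_ext_eq0 _ _ _ _ p q) ?scaler0 //.
    by apply: contra ab => /eqP pq; rewrite ap bq pq.
  by rewrite !ffunE -ap -bq [a == i]eq_sym [b == i]eq_sym (negbTE ia) (negbTE ib).
have Fab : F a b = 0.
  rewrite /F linearZ /=.
  have ba' : b != a by rewrite eq_sym.
  have [p ap _] := unlift_some ba'.
  have -> : face a b x = upd (face a b x) p 0.
    apply/ffunP => k; rewrite !ffunE.
    by case: (eqVneq k p) => [->|//]; rewrite -ap eqxx -xab lie_alt.
  by rewrite tens_upd0 !linear0.
(* [x_i, x] with either copy of x deleted: the faces agree, the signs differ *)
have Fleft (i : 'I_n) : (i < a)%N -> F i a + F i b = 0.
  move=> ia; have -> : F i b = - F i a; last by rewrite subrr.
  have -> : F i b = CL_CE n.-1 ((-1) ^+ b.+1 *: tens (face i a x)).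
    rewrite /F; congr (CL_CE _ (_ *: tens _)); apply/ffunP => k; rewrite !ffunE xab.
    have [ka|ka] := eqVneq (k : nat) a; last first.
      by have -> // : fintype.lift b k = fintype.lift a k;
         apply: val_inj; rewrite /= /bump; move: ka; lia.
    have -> : fintype.lift b k = a by apply: val_inj; rewrite /= /bump; lia.
    have -> : fintype.lift a k = b by apply: val_inj; rewrite /= /bump; lia.
    rewrite -xab; case: eqP => [/(congr1 val) /=|_]; first by lia.
    by case: eqP => [/(congr1 val) /=|_] //; lia.
  by rewrite /F ba exprS mulN1r scaleNr linearN.
(* [x, x_j] in either of two adjacent places, the other one being x *)
have Fright (j : 'I_n) : (b < j)%N -> F a j + F b j = 0.
  move=> bj.
  have ja : j != a by apply/eqP => /(congr1 val) /=; lia.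
  have jb : j != b by apply/eqP => /(congr1 val) /=; lia.
  have [p ap _] := unlift_some ja; have [q bq _] := unlift_some jb.
  have pq : p != q by apply: contra ab => /eqP pq; rewrite ap bq pq.
  have Ea l : (fintype.lift j l == a) = (l == p) by rewrite ap (inj_eq lift_inj).
  have Eb l : (fintype.lift j l == b) = (l == q) by rewrite bq (inj_eq lift_inj).
  pose y := face a j x; pose w := [lie x a, x j].
  have Fa : face a j x = upd (upd y p w) q (x a).
    apply/ffunP => l; rewrite !ffunE Ea; case: (eqVneq l q) => [->|_].
      by rewrite eq_sym (negbTE pq) -bq xab.
    by case: (l == p).
  have Fb : face b j x = upd (upd y p (x a)) q w.
    apply/ffunP => l; rewrite !ffunE Ea Eb /w xab; case: (eqVneq l q) => // _.
    by case: (eqVneq l p) => [->|//]; rewrite -ap xab.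
  rewrite /F !linearZ /= Fa Fb (tens_ext_swap _ _ _ pq) -scalerDr addNr.
  by rewrite scaler0.
rewrite (bigD1 a) /= 1?[X in _ + X](bigD1 b) /= 1?eq_sym //.
rewrite [X in _ + (_ + X)]big1 ?addr0 => [|i /andP[ia ib]]; last first.
  have [lia|lai] := ltnP i a; last first.
    rewrite big1 // => j ij; apply: F0 => //.
    - by apply/eqP => /(congr1 val) /=; lia.
    - by apply/eqP => /(congr1 val) /=; lia.
    apply/eqP => /(congr1 val) /= jb; move: ia ib; rewrite -!val_eqE /=; lia.
  rewrite (bigD1 a) //= (bigD1 b) /=; last by rewrite eq_sym ab andbT; lia.
  rewrite addrA Fleft // add0r big1 // => j /andP[/andP[ij ja] jb].
  by apply: F0 => //; apply/eqP => /(congr1 val) /=; lia.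
rewrite (bigD1 b) /=; last by lia.
rewrite Fab add0r (eq_bigl (fun j : 'I_n => (b < j)%N)); last first.
  by move=> j; rewrite -val_eqE /=; lia.
by rewrite -big_split big1 //= => j; apply: Fright.
Qed.

Lemma ce_bd_alt n (t : CL g n) :
  ext_rel t -> (CL_CE n.-1 \o leibniz_d g n) t = 0.
Proof.
case=> x [i [j [ij xij ->]]].
change (CL_CE n.-1 (leibniz_d g n (tens x)) = 0); rewrite leibniz_dE.
apply: (multilinear_alt (f := fun y => CL_CE n.-1 (leibniz_bd y))) ij xij.
  by move=> y k a u v; rewrite leibniz_bd_multilinear linearP.
exact: ce_bd_adjacent.
Qed.

(* By ce_dE, this is the formula of leibniz_d with exterior products. *)
Definition ce_d n : {linear CE n -> CE n.-1} := lquot_lift (@ce_bd_alt n).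

Lemma ce_dE n (t : CL g n) : ce_d n (CL_CE n t) = CL_CE n.-1 (leibniz_d g n t).
Proof. exact: (lquot_liftE (@ce_bd_alt n)). Qed.

Definition HCE n : lmodType K := homology (ce_d n.+1) (ce_d n).

(* t_g in degree n, induced by the projections CL_CE *)
Definition HL_HCE n : {linear HL g n -> HCE n} :=
  homology_map (fun t => esym (ce_dE t)) (fun t => esym (ce_dE t)).
End LieComplex.

Section LiePresentation.
Variables (K : fieldType) (X : Type).

Inductive lie_term : Type :=
| LGen of X
| LZero
| LOpp of lie_term
| LAdd of lie_term & lie_term
| LScale of K & lie_term
| LBracket of lie_term & lie_term.

HB.instance Definition _ := gen_eqMixin lie_term.
HB.instance Definition _ := gen_choiceMixin lie_term.

Variable R : lie_term -> lie_term -> Prop.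

(* the smallest congruence that contains R and satisfies the axioms of a Lie
   algebra over K *)
Inductive lie_cong : lie_term -> lie_term -> Prop :=
| lc_rel s t : R s t -> lie_cong s t
| lc_refl s : lie_cong s s
| lc_sym s t : lie_cong s t -> lie_cong t s
| lc_trans s t u : lie_cong s t -> lie_cong t u -> lie_cong s u
| lc_opp s s' : lie_cong s s' -> lie_cong (LOpp s) (LOpp s')
| lc_add s s' t t' : lie_cong s s' -> lie_cong t t' ->
    lie_cong (LAdd s t) (LAdd s' t')
| lc_scale a s s' : lie_cong s s' -> lie_cong (LScale a s) (LScale a s')
| lc_bracket s s' t t' : lie_cong s s' -> lie_cong t t' ->
    lie_cong (LBracket s t) (LBracket s' t')
| lc_addA s t u : lie_cong (LAdd s (LAdd t u)) (LAdd (LAdd s t) u)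
| lc_addC s t : lie_cong (LAdd s t) (LAdd t s)
| lc_add0 s : lie_cong (LAdd LZero s) s
| lc_addN s : lie_cong (LAdd (LOpp s) s) LZero
| lc_scaleA a b s : lie_cong (LScale a (LScale b s)) (LScale (a * b) s)
| lc_scale1 s : lie_cong (LScale 1 s) s
| lc_scaleDr a s t :
    lie_cong (LScale a (LAdd s t)) (LAdd (LScale a s) (LScale a t))
| lc_scaleDl a b s :
    lie_cong (LScale (a + b) s) (LAdd (LScale a s) (LScale b s))
| lc_linearl a s t u :
    lie_cong (LBracket (LAdd (LScale a s) t) u)
             (LAdd (LScale a (LBracket s u)) (LBracket t u))
| lc_linearr a s t u :
    lie_cong (LBracket s (LAdd (LScale a t) u))
             (LAdd (LScale a (LBracket s t)) (LBracket s u))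
| lc_leibniz s t u :
    lie_cong (LBracket s (LBracket t u))
             (LAdd (LBracket (LBracket s t) u)
                   (LOpp (LBracket (LBracket s u) t)))
| lc_alt s : lie_cong (LBracket s s) LZero.

Definition lie_congb (s t : lie_term) : bool := `[< lie_cong s t >].

Lemma lie_congb_refl : reflexive lie_congb.
Proof. by move=> s; apply/asboolP/lc_refl. Qed.
Lemma lie_congb_sym : symmetric lie_congb.
Proof. by move=> s t; apply/asboolP/asboolP => /lc_sym. Qed.
Lemma lie_congb_trans : transitive lie_congb.
Proof.
by move=> t s u /asboolP st /asboolP tu; apply/asboolP/(lc_trans st tu).
Qed.

Canonical lie_congb_equiv :=
  EquivRel lie_congb lie_congb_refl lie_congb_sym lie_congb_trans.

Definition lie_pres : Type := {eq_quot lie_congb}.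
HB.instance Definition _ := Choice.on lie_pres.
HB.instance Definition _ := Quotient.on lie_pres.

Definition lp_pi (t : lie_term) : lie_pres := \pi_lie_pres t.

Lemma lp_piP s t : lp_pi s = lp_pi t <-> lie_cong s t.
Proof.
have E : (lp_pi s == lp_pi t) = lie_congb s t by exact: (eqmodE lie_congb_equiv).
by split=> [/eqP|st]; [rewrite E => /asboolP | apply/eqP; rewrite E; apply/asboolP].
Qed.

Lemma lp_reprK q : lp_pi (repr q) = q.
Proof. exact: (@reprK _ lie_pres). Qed.

Lemma lp_repr t : lie_cong (repr (lp_pi t)) t.
Proof. by apply/lp_piP; rewrite lp_reprK. Qed.

Definition lp_zero : lie_pres := lp_pi LZero.
Definition lp_opp (p : lie_pres) : lie_pres := lp_pi (LOpp (repr p)).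
Definition lp_add (p q : lie_pres) : lie_pres := lp_pi (LAdd (repr p) (repr q)).
Definition lp_scale (a : K) (p : lie_pres) : lie_pres := lp_pi (LScale a (repr p)).
Definition lp_bracket (p q : lie_pres) : lie_pres :=
  lp_pi (LBracket (repr p) (repr q)).

Lemma lp_oppE s : lp_opp (lp_pi s) = lp_pi (LOpp s).
Proof. exact/lp_piP/lc_opp/lp_repr. Qed.
Lemma lp_addE s t : lp_add (lp_pi s) (lp_pi t) = lp_pi (LAdd s t).
Proof. by apply/lp_piP/lc_add; apply: lp_repr. Qed.
Lemma lp_scaleE a s : lp_scale a (lp_pi s) = lp_pi (LScale a s).
Proof. exact/lp_piP/lc_scale/lp_repr. Qed.
Lemma lp_bracketE s t : lp_bracket (lp_pi s) (lp_pi t) = lp_pi (LBracket s t).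
Proof. by apply/lp_piP/lc_bracket; apply: lp_repr. Qed.

Definition lpE := (lp_oppE, lp_addE, lp_scaleE, lp_bracketE).

Lemma lp_addA : associative lp_add.
Proof.
move=> p q r; rewrite -(lp_reprK p) -(lp_reprK q) -(lp_reprK r) !lpE.
exact/lp_piP/lc_addA.
Qed.
Lemma lp_addC : commutative lp_add.
Proof. by move=> p q; apply/lp_piP/lc_addC. Qed.
Lemma lp_add0 : left_id lp_zero lp_add.
Proof. by move=> p; rewrite -(lp_reprK p) !lpE; apply/lp_piP/lc_add0. Qed.
Lemma lp_addN : left_inverse lp_zero lp_opp lp_add.
Proof. by move=> p; rewrite -(lp_reprK p) !lpE; apply/lp_piP/lc_addN. Qed.

HB.instance Definition _ := GRing.isZmodule.Build lie_pres
  lp_addA lp_addC lp_add0 lp_addN.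

Lemma lp_piD s t : lp_pi s + lp_pi t = lp_pi (LAdd s t).
Proof. exact: lp_addE. Qed.
Lemma lp_piN s : - lp_pi s = lp_pi (LOpp s).
Proof. exact: lp_oppE. Qed.

Lemma lp_scaleA a b p : lp_scale a (lp_scale b p) = lp_scale (a * b) p.
Proof. by rewrite -(lp_reprK p) !lpE; apply/lp_piP/lc_scaleA. Qed.
Lemma lp_scale1 : left_id 1 lp_scale.
Proof. by move=> p; rewrite -(lp_reprK p) !lpE; apply/lp_piP/lc_scale1. Qed.
Lemma lp_scaleDr : right_distributive lp_scale +%R.
Proof.
move=> a p q; rewrite -(lp_reprK p) -(lp_reprK q) !(lp_piD, lpE).
exact/lp_piP/lc_scaleDr.
Qed.
Lemma lp_scaleDl p : {morph lp_scale^~ p : a b / a + b}.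
Proof.
move=> a b; rewrite -(lp_reprK p) !(lp_piD, lpE).
exact/lp_piP/lc_scaleDl.
Qed.

HB.instance Definition _ := GRing.Zmodule_isLmodule.Build K lie_pres
  lp_scaleA lp_scale1 lp_scaleDr lp_scaleDl.

Lemma lp_piZ a s : a *: lp_pi s = lp_pi (LScale a s).
Proof. exact: lp_scaleE. Qed.

Lemma lp_linearl a (p q r : lie_pres) :
  lp_bracket (a *: p + q) r = a *: lp_bracket p r + lp_bracket q r.
Proof.
rewrite -(lp_reprK p) -(lp_reprK q) -(lp_reprK r) lp_piZ lp_piD.
rewrite !lp_bracketE lp_piZ lp_piD.
exact/lp_piP/lc_linearl.
Qed.
Lemma lp_linearr a (p q r : lie_pres) :
  lp_bracket p (a *: q + r) = a *: lp_bracket p q + lp_bracket p r.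
Proof.
rewrite -(lp_reprK p) -(lp_reprK q) -(lp_reprK r) lp_piZ lp_piD.
rewrite !lp_bracketE lp_piZ lp_piD.
exact/lp_piP/lc_linearr.
Qed.
Lemma lp_leibniz (p q r : lie_pres) :
  lp_bracket p (lp_bracket q r)
  = lp_bracket (lp_bracket p q) r - lp_bracket (lp_bracket p r) q.
Proof.
rewrite -(lp_reprK p) -(lp_reprK q) -(lp_reprK r) !lpE lp_piN lp_piD.
exact/lp_piP/lc_leibniz.
Qed.
Lemma lp_alt (p : lie_pres) : lp_bracket p p = 0.
Proof. by rewrite -(lp_reprK p) !lpE; apply/lp_piP/lc_alt. Qed.

HB.instance Definition _ := Lmodule_isLeibniz.Build K lie_pres
  lp_linearl lp_linearr lp_leibniz.
HB.instance Definition _ := Leibniz_isLie.Build K lie_pres lp_alt.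

Definition lp_gen (x : X) : lie_pres := lp_pi (LGen x).
End LiePresentation.

Section TensorSquare.
Variables (K : fieldType) (g : lieAlgType K).

Local Notation term := (lie_term K (g * g)).
(* x ** y is the symbol x * y; +t, -t are formal operations on terms *)
Local Notation "x ** y" := (LGen K (x, y)) (at level 40).
Local Notation "s '+t' t" := (LAdd s t) (at level 50).
Local Notation "s '-t' t" := (LAdd s (LOpp t)) (at level 50).

Inductive tsq_rel : term -> term -> Prop :=
| tsq_linearl (a : K) x x' y :
    tsq_rel ((a *: x + x') ** y) (LScale a (x ** y) +t x' ** y)
| tsq_linearr (a : K) x y y' :
    tsq_rel (x ** (a *: y + y')) (LScale a (x ** y) +t x ** y')
| tsq_actl x x' y :
    tsq_rel ([lie x, x'] ** y) (x ** [lie x', y] -t x' ** [lie x, y])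
| tsq_actr x y y' :
    tsq_rel (x ** [lie y, y']) ([lie y', x] ** y -t [lie y, x] ** y')
| tsq_bracket x y x' y' :
    tsq_rel (LBracket (x ** y) (x' ** y')) (LOpp ([lie y, x] ** [lie x', y'])).

Definition tsquare : lieAlgType K := lie_pres tsq_rel.
End TensorSquare.

(* [g, g] is the linear span of the brackets *)
Definition perfect (K : fieldType) (g : lieAlgType K) : Prop :=
  forall z : g, lspan (fun w => exists x y, w = [lie x, y]) z.

(* Main.v *)
(** Write h for the tensor square and u : h -> g for the map x * y |-> [x, y].
    The relations of h give [a, b] = u(a) * u(b), so ker u is central, and if g
    is perfect then u is onto and h is perfect.  The map iota is HL_2(u).

    Injectivity: by perfectness of h, a tensor with a factor in ker u is a
    boundary in h (x) h, so lifting along u defines a map from g (x) g to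
    (h (x) h) / im d_3; it inverts u (x) u modulo boundaries and kills im d_3.

    Exactness: the map theta : g (x) g -> h, x (x) y |-> x * y, satisfies
    theta(u a (x) u b) = [a, b], so a class lies in the image of iota iff theta
    kills it.  Moreover theta vanishes exactly on im d_3 plus the squares
    x (x) x.  For the converse inclusion, (g (x) g) modulo these is a Lie algebra
    W under [m, n] = c(m) ^ c(n), where c(x ^ y) = [x, y], and x * y |-> x ^ y
    defines a Lie morphism h -> W. *)
Require Import Defs.
From HB Require Import structures.
From mathcomp Require Import all_boot all_order all_algebra.
From mathcomp Require Import boolp.
From mathcomp Require Import freeg.

Set Implicit Arguments.
Unset Strict Implicit.
Unset Printing Implicit Defensive.

Import GRing.Theory.
Local Open Scope ring_scope.

(** * Spans, linear maps and homology classes *)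

Section SpanTheory.
Variables (K : fieldType) (V : lmodType K).

Lemma lspan_submod (S : V -> Prop) :
  S 0 -> (forall a u v, S u -> S v -> S (a *: u + v)) ->
  forall v, lspan S v -> S v.
Proof. by move=> S0 SP v; elim=> // a u w _ Su _ Sw; apply: SP. Qed.

Lemma lspan_incl (S T : V -> Prop) v :
  (forall w, S w -> T w) -> lspan S v -> lspan T v.
Proof.
move=> ST; elim=> [w /ST/lspan_gen//||a u w _ Tu _ Tw]; first exact: lspan0.
exact: lspanP.
Qed.

Lemma lspan_image (A : lmodType K) (f : {linear A -> V}) v :
  lspan (fun w => exists a, w = f a) v -> exists a, v = f a.
Proof.
apply: lspan_submod => [|c u w [a ->] [b ->]]; first by exists 0; rewrite linear0.
by exists (c *: a + b); rewrite linearP.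
Qed.

End SpanTheory.

Section BareLinear.
Variables (K : fieldType) (U V : lmodType K) (f : U -> V).
Hypothesis fL : linear f.

(** Stated for a bare function, so that it applies to a bilinear map with one argument frozen,
    without bundling that partial map. *)
Lemma linear_at0 : f 0 = 0.
Proof. by have := fL (-1) 0 0; rewrite scaler0 addr0 scaleN1r addNr. Qed.

Lemma linear_opp u : f (- u) = - f u.
Proof. by have := fL (-1) u 0; rewrite linear_at0 !addr0 !scaleN1r. Qed.
End BareLinear.

Section HomologyTheory.
Variables (K : fieldType) (A B C : lmodType K).
Variables (d1 : {linear A -> B}) (d0 : {linear B -> C}).

Definition cycle_class : {linear cycles d0 -> homology d1 d0} :=
  lquot_pi (fun z : cycles d0 => exists a : A, val z = d1 a).

(** The boundaries already form a subspace, so passing to their span in the definition of homology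
    adds nothing. *)
Lemma cycle_class_eq0 (z : cycles d0) :
  cycle_class z = 0 <-> exists a, val z = d1 a.
Proof.
split=> [/lquot_pi_eq0|za]; last exact/lquot_pi_eq0/lspan_gen.
apply: (lspan_submod (S := fun w : cycles d0 => exists a, val w = d1 a))
  => [|c u v [a ua] [b vb]].
  by exists 0; rewrite linear0.
by exists (c *: a + b); rewrite linearP -ua -vb.
Qed.

Lemma cycle_classP (q : homology d1 d0) :
  exists z : cycles d0, cycle_class z = q.
Proof. by exists (generic_quotient.repr q); apply: lquot_reprK. Qed.

Definition cycle_of (z : B) (dz : d0 z = 0) : cycles d0 :=
  exist _ z (introT eqP dz).

Lemma cycle_d (z : cycles d0) : d0 (val z) = 0.
Proof. exact/eqP/(valP z). Qed.
End HomologyTheory.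

Lemma homology_map_class (K : fieldType) (A B C A' B' C' : lmodType K)
    (d1 : {linear A -> B}) (d0 : {linear B -> C})
    (d1' : {linear A' -> B'}) (d0' : {linear B' -> C'})
    (fA : {linear A -> A'}) (fB : {linear B -> B'}) (fC : {linear C -> C'})
    (comm1 : forall a, fB (d1 a) = d1' (fA a))
    (comm0 : forall b, fC (d0 b) = d0' (fB b)) (z : cycles d0) :
  homology_map comm1 comm0 (cycle_class d1 d0 z)
  = cycle_class d1' d0' (cycles_map comm0 z).
Proof. exact: lquot_liftE. Qed.

(** * Tensor powers: generation, functoriality, low degrees *)

Section TensorTheory.
Variables (K : fieldType).

(** A representative in the free module is a combination of its basis elements. Eliminating this
    span is the induction principle by which linear identities are checked on pure tensors. *)
Lemma tens_span (V : lmodType K) n (t : tpower V n) :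
  lspan (fun w => exists x, w = tens x) t.
Proof.
rewrite -(lquot_reprK t) -[generic_quotient.repr t]freeg_sumE.
rewrite linear_sum; elim/big_ind: _ => [||x _].
- exact: lspan0.
- by move=> u v; apply: lspanD.
rewrite -[X in lspan _ X]addr0.
have -> : << coeff x (generic_quotient.repr t) *g x >>
        = coeff x (generic_quotient.repr t) *: << x >> :> {freeg _ / K}.
  by apply/eqP/freeg_eqP => y; rewrite coeff_fgscale !coeffU mul1r.
by rewrite linearZ /=; apply: lspanP (lspan0 _); apply: lspan_gen; exists x.
Qed.

Section Map.
Variables (V W : lmodType K) (f : {linear V -> W}) (n : nat).

Definition fmap_ffun (x : {ffun 'I_n -> V}) : {ffun 'I_n -> W} :=
  [ffun i => f (x i)].

Lemma fmap_ffun_upd x i u :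
  fmap_ffun (upd x i u) = upd (fmap_ffun x) i (f u).
Proof. by apply/ffunP => k; rewrite !ffunE; case: eqP. Qed.

Lemma tens_fmap_multilinear (x : {ffun 'I_n -> V}) i a u v :
  tens (fmap_ffun (upd x i (a *: u + v)))
  = a *: tens (fmap_ffun (upd x i u)) + tens (fmap_ffun (upd x i v)).
Proof. by rewrite !fmap_ffun_upd linearP tens_updP. Qed.

Definition tmap : {linear tpower V n -> tpower W n} :=
  tens_lift (f := fun x => tens (fmap_ffun x)) tens_fmap_multilinear.

Lemma tmapE x : tmap (tens x) = tens (fmap_ffun x).
Proof. exact: (tens_liftE (f := fun x => tens (fmap_ffun x))). Qed.

(** A pure tensor is lifted factor by factor through a chosen section, which need not be linear. *)
Lemma tmap_surj : (forall w, exists v, f v = w) ->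
  forall t, exists s, tmap s = t.
Proof.
move=> fs t; elim: (tens_span t) => [_ [x ->]||a _ _ _ [u <-] _ [v <-]].
- have [s sP] := choice fs.
  exists (tens [ffun i => s (x i)]); rewrite tmapE; congr tens.
  by apply/ffunP => i; rewrite !ffunE sP.
- by exists 0; rewrite linear0.
by exists (a *: u + v); rewrite linearP.
Qed.
End Map.

Section Small.
Variable V : lmodType K.

Definition tens1 (v : V) : tpower V 1 := tens [ffun=> v].
Definition pair2 (u v : V) : {ffun 'I_2 -> V} :=
  [ffun i : 'I_2 => if i == 0 then u else v].
Definition tens2 (u v : V) : tpower V 2 := tens (pair2 u v).

Lemma tens1_linear : linear tens1.
Proof.
move=> a u v; have E w : tens1 w = tens (upd [ffun=> 0] ord0 w).
  by congr tens; apply/ffunP => i; rewrite !ffunE ord1.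
by rewrite !E tens_updP.
Qed.

Lemma tens1_0 : tens1 0 = 0.
Proof. exact: linear_at0 tens1_linear. Qed.

Lemma tens1E (x : {ffun 'I_1 -> V}) : tens x = tens1 (x 0).
Proof. by congr tens; apply/ffunP => i; rewrite !ffunE ord1. Qed.

Lemma pair2E (x : {ffun 'I_2 -> V}) : x = pair2 (x 0) (x 1).
Proof.
by apply/ffunP => i; rewrite !ffunE; case: i => [[|[|//]]] p /=; congr (x _);
  apply: val_inj.
Qed.

Lemma tens2E (x : {ffun 'I_2 -> V}) : tens x = tens2 (x 0) (x 1).
Proof. by rewrite {1}[x]pair2E. Qed.

Lemma tens2_linearl a u v w : tens2 (a *: u + v) w = a *: tens2 u w + tens2 v w.
Proof.
have E y : tens2 y w = tens (upd (pair2 0 w) 0 y).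
  by congr tens; apply/ffunP => i; rewrite !ffunE; case: eqP.
by rewrite !E tens_updP.
Qed.

Lemma tens2_linearr a w u v : tens2 w (a *: u + v) = a *: tens2 w u + tens2 w v.
Proof.
have E y : tens2 w y = tens (upd (pair2 w 0) 1 y).
  by congr tens; apply/ffunP => i; rewrite !ffunE; case: i => [[|[|//]]] p.
by rewrite !E tens_updP.
Qed.

Lemma ext_rel2P (t : tpower V 2) : ext_rel t <-> exists v, t = tens2 v v.
Proof.
split=> [[x [i [j [ij xij ->]]]]|[v ->]].
  exists (x 0); rewrite tens2E; congr tens2; move: xij.
  have {ij} : (i == 0) && (j == 1) || (i == 1) && (j == 0).
    by case: i j ij => [[|[|//]]] p [[|[|//]]] q.
  by case/orP=> /andP[/eqP-> /eqP->].
by exists (pair2 v v), 0, 1; split=> //; rewrite !ffunE.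
Qed.

(** There are no two distinct indices in degree one, so the exterior relations are empty. *)
Lemma tens_ext1_inj (t : tpower V 1) : tens_ext V 1 t = 0 -> t = 0.
Proof.
move/lquot_pi_eq0; elim=> // [v [x [i [j []]]]|a u v _ -> _ ->].
  by rewrite !ord1 eqxx.
by rewrite scaler0 addr0.
Qed.
End Small.

Section Bilinear.
Variables (V W : lmodType K) (f : V -> V -> W).
Hypothesis fl : forall a u v w, f (a *: u + v) w = a *: f u w + f v w.
Hypothesis fr : forall a w u v, f w (a *: u + v) = a *: f w u + f w v.

Lemma bilinear_multilinear (x : {ffun 'I_2 -> V}) i a u v :
  f (upd x i (a *: u + v) 0) (upd x i (a *: u + v) 1)
  = a *: f (upd x i u 0) (upd x i u 1) + f (upd x i v 0) (upd x i v 1).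
Proof.
by rewrite !ffunE; case: i => [[|[|//]]] p /=; [rewrite fl|rewrite fr].
Qed.

Definition tens2_lift : {linear tpower V 2 -> W} :=
  tens_lift (f := fun x : {ffun 'I_2 -> V} => f (x 0) (x 1))
    bilinear_multilinear.

Lemma tens2_liftE u v : tens2_lift (tens2 u v) = f u v.
Proof. by rewrite [LHS](tens_liftE bilinear_multilinear) !ffunE. Qed.
End Bilinear.
End TensorTheory.

(** * The Leibniz boundary in degrees two and three *)

Section LeibnizLowDegree.
Variables (K : fieldType) (g : leibnizAlgType K).

Definition bracket_map : {linear tpower g 2 -> g} :=
  tens2_lift (@lie_linearl K g) (@lie_linearr K g).

Lemma bracket_mapE x y : bracket_map (tens2 x y) = [lie x, y].
Proof. exact: tens2_liftE. Qed.

(** The only face comes from the index pair (0, 1), with sign (-1)^2 = 1. *)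
Lemma leibniz_d2E (t : tpower g 2) : leibniz_d g 2 t = tens1 (bracket_map t).
Proof.
elim: (tens_span t) => [_ [x ->]||a u v _ Eu _ Ev].
- rewrite leibniz_dE tens2E bracket_mapE /leibniz_bd.
  under eq_bigr do rewrite big_mkcond /=.
  rewrite !big_ord_recl !big_ord0 /= !addr0 !add0r sqrrN expr1n scale1r.
  rewrite [LHS]tens1E !ffunE /=; congr (tens1 [lie x _, x _]); exact: val_inj.
- by rewrite !linear0 tens1_0.
by rewrite !linearP Eu Ev tens1_linear.
Qed.

Lemma leibniz_d2_eq0 (t : tpower g 2) :
  leibniz_d g 2 t = 0 <-> bracket_map t = 0.
Proof.
rewrite leibniz_d2E; split=> [|->]; last exact: tens1_0.
(* Reading off the single factor is a linear map that inverts [tens1]. *)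
have fP (x : {ffun 'I_1 -> g}) i a u v :
    upd x i (a *: u + v) 0 = a *: upd x i u 0 + upd x i v 0.
  by rewrite !ffunE !ord1.
move/(congr1 (tens_lift (f := fun x : {ffun 'I_1 -> g} => x 0) fP)).
by rewrite linear0 tens_liftE ffunE.
Qed.

Lemma leibniz_d3E (x : {ffun 'I_3 -> g}) (x0 := x 0) (x1 := x 1)
    (x2 := x ord_max) :
  leibniz_d g 3 (tens x)
  = tens2 [lie x0, x1] x2 - tens2 [lie x0, x2] x1 - tens2 x0 [lie x1, x2].
Proof.
rewrite leibniz_dE /leibniz_bd; under eq_bigr do rewrite big_mkcond /=.
rewrite !big_ord_recl !big_ord0 /= !addr0 !add0r.
rewrite sqrrN expr1n exprS sqrrN expr1n mulr1 !scaleN1r scale1r.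
rewrite !tens2E !ffunE /=.
by congr (tens2 [lie x _, x _] (x _) - tens2 [lie x _, x _] (x _)
          - tens2 (x _) [lie x _, x _]); exact: val_inj.
Qed.

Lemma bracket_map_d3 (t : tpower g 3) : bracket_map (leibniz_d g 3 t) = 0.
Proof.
elim: (tens_span t) => [_ [x ->]||a u v _ Eu _ Ev]; rewrite ?linear0 //.
  by rewrite leibniz_d3E !linearB !bracket_mapE leibniz_identity subrr.
by rewrite !linearP Eu Ev scaler0 addr0.
Qed.

Definition triple (x y z : g) : {ffun 'I_3 -> g} :=
  [ffun i : 'I_3 => if i == 0 then x else if i == 1 then y else z].

Lemma leibniz_d_triple x y z :
  leibniz_d g 3 (tens (triple x y z))
  = tens2 [lie x, y] z - tens2 [lie x, z] y - tens2 x [lie y, z].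
Proof. by rewrite leibniz_d3E !ffunE. Qed.
End LeibnizLowDegree.

(** * Functoriality of Leibniz homology *)

Section LeibnizFunctor.
Variables (K : fieldType) (h g : leibnizAlgType K) (u : {linear h -> g}).
Hypothesis uB : forall a b, u [lie a, b] = [lie u a, u b].

Lemma face_fmap n (i j : 'I_n) (x : {ffun 'I_n -> h}) :
  face i j (fmap_ffun u x) = fmap_ffun u (face i j x).
Proof. by apply/ffunP => k; rewrite !ffunE; case: eqP; rewrite ?uB. Qed.

Lemma leibniz_d_tmap n (t : tpower h n) :
  tmap u n.-1 (leibniz_d h n t) = leibniz_d g n (tmap u n t).
Proof.
elim: (tens_span t) => [_ [x ->]||a v w _ Ev _ Ew]; rewrite ?linear0 //.
  rewrite tmapE !leibniz_dE /leibniz_bd linear_sum; apply: eq_bigr => i _.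
  rewrite linear_sum; apply: eq_bigr => j _.
  by rewrite linearZ tmapE face_fmap.
by rewrite !linearP Ev Ew.
Qed.

Definition HL_map n : {linear HL h n -> HL g n} :=
  homology_map (@leibniz_d_tmap n.+1) (@leibniz_d_tmap n).
End LeibnizFunctor.

(** * Induction and universal property for presented Lie algebras *)

Section PresentationTheory.
Variables (K : fieldType) (X : Type).
Variable R : lie_term K X -> lie_term K X -> Prop.

Lemma lp_ind (P : lie_pres R -> Prop) :
  (forall x, P (lp_gen R x)) -> P 0 ->
  (forall a p q, P p -> P q -> P (a *: p + q)) ->
  (forall p q, P p -> P q -> P [lie p, q]) -> forall p, P p.
Proof.
move=> Pg P0 PP PB p; rewrite -(lp_reprK p).
elim: (generic_quotient.repr p) => {p} [x||t Pt|s Ps t Pt|a t Pt|s Ps t Pt] //.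
- exact: Pg.
- by rewrite -lp_piN -scaleN1r -[_ *: _]addr0; apply: PP.
- by rewrite -lp_piD -[lp_pi R s]scale1r; apply: PP.
- by rewrite -lp_piZ -[_ *: _]addr0; apply: PP.
by rewrite -lp_bracketE; apply: PB.
Qed.

Section Lift.
Variables (k : lieAlgType K) (f : X -> k).

Fixpoint lt_eval (t : lie_term K X) : k :=
  match t with
  | LGen x => f x
  | LZero => 0
  | LOpp t => - lt_eval t
  | LAdd s t => lt_eval s + lt_eval t
  | LScale a t => a *: lt_eval t
  | LBracket s t => [lie lt_eval s, lt_eval t]
  end.

Hypothesis fR : forall s t, R s t -> lt_eval s = lt_eval t.

(** Apart from the relations [R], covered by [fR], each rule of the congruence is a law of equality
    or an axiom that holds in the Lie algebra [k]. *)
Lemma lt_eval_cong s t : lie_cong R s t -> lt_eval s = lt_eval t.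
Proof.
elim=> //=.
- by move=> ? ? ? _ -> _ ->.
- by move=> ? ? _ ->.
- by move=> ? ? ? ? _ -> _ ->.
- by move=> ? ? ? _ ->.
- by move=> ? ? ? ? _ -> _ ->.
- by move=> *; rewrite addrA.
- by move=> *; rewrite addrC.
- by move=> *; rewrite add0r.
- by move=> *; rewrite addNr.
- by move=> *; rewrite scalerA.
- by move=> *; rewrite scale1r.
- by move=> *; rewrite scalerDr.
- by move=> *; rewrite scalerDl.
- by move=> *; rewrite lie_linearl.
- by move=> *; rewrite lie_linearr.
- by move=> *; rewrite leibniz_identity.
by move=> *; rewrite lie_alt.
Qed.

Definition lp_lift_fun (p : lie_pres R) : k := lt_eval (generic_quotient.repr p).

Lemma lp_lift_pi t : lp_lift_fun (lp_pi R t) = lt_eval t.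
Proof. exact/lt_eval_cong/lp_repr. Qed.

Lemma lp_lift_linear : linear lp_lift_fun.
Proof.
move=> a p q; rewrite -(lp_reprK p) -(lp_reprK q) lp_piZ lp_piD.
by rewrite !lp_lift_pi.
Qed.

HB.instance Definition _ := GRing.isLinear.Build K (lie_pres R) k _ lp_lift_fun
  lp_lift_linear.

Definition lp_lift : {linear lie_pres R -> k} := lp_lift_fun.

Lemma lp_lift_gen x : lp_lift (lp_gen R x) = f x.
Proof. exact: lp_lift_pi. Qed.

Lemma lp_lift_bracket p q : lp_lift [lie p, q] = [lie lp_lift p, lp_lift q].
Proof.
rewrite -(lp_reprK p) -(lp_reprK q) [[lie _, _]]lp_bracketE.
by rewrite [LHS]lp_lift_pi /= -!lp_lift_pi.
Qed.
End Lift.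
End PresentationTheory.

(** * The tensor square, its commutator map and the map theta *)

Section TensorSquareTheory.
Variables (K : fieldType) (g : lieAlgType K).
Implicit Types (x y z : g) (p q : tsquare g).

Definition star x y : tsquare g := lp_gen (@tsq_rel K g) (x, y).

Lemma star_linearl a x x' y : star (a *: x + x') y = a *: star x y + star x' y.
Proof. by rewrite lp_piZ lp_piD; apply/lp_piP/lc_rel/tsq_linearl. Qed.

Lemma star_linearr a x y y' : star x (a *: y + y') = a *: star x y + star x y'.
Proof. by rewrite lp_piZ lp_piD; apply/lp_piP/lc_rel/tsq_linearr. Qed.

Lemma star_actr x y y' :
  star x [lie y, y'] = star [lie y', x] y - star [lie y, x] y'.
Proof. by rewrite lp_piN lp_piD; apply/lp_piP/lc_rel/tsq_actr. Qed.

Lemma star0l y : star 0 y = 0.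
Proof. exact: linear_at0 (fun a x x' => star_linearl a x x' y). Qed.

Lemma star0r x : star x 0 = 0.
Proof. exact: linear_at0 (fun a y y' => star_linearr a x y y'). Qed.

Lemma starN x y : star (- x) y = - star x y.
Proof. exact: linear_opp (fun a x x' => star_linearl a x x' y) x. Qed.

(** The defining relation has [y, x] and a minus sign; anticommutativity absorbs the sign. *)
Lemma star_bracket x y x' y' :
  [lie star x y, star x' y'] = star [lie x, y] [lie x', y'].
Proof.
rewrite (lie_anti x y) starN lp_piN.
by rewrite [LHS]lp_bracketE; apply/lp_piP/lc_rel/tsq_bracket.
Qed.

(** The symbols generate only as a Lie algebra a priori, but by [star_bracket] a bracket of two
    symbols is again a symbol. *)
Lemma star_span p : lspan (fun w => exists x y, w = star x y) p.
Proof.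
elim/lp_ind: p => [[x y]||a p q|p q Sp Sq].
- by apply: lspan_gen; exists x, y.
- exact: lspan0.
- exact: lspanP.
elim: Sp => [_ [x [y ->]]||a p' q' _ Sp _ Sq'].
- elim: Sq => [_ [x' [y' ->]]||a p' q' _ Sp _ Sq'].
  + by apply: lspan_gen; rewrite star_bracket; exists [lie x, y], [lie x', y'].
  + by rewrite lie0r; apply: lspan0.
  + by rewrite lie_linearr; apply: lspanP.
- by rewrite lie_anti lie0r oppr0; apply: lspan0.
by rewrite lie_linearl; apply: lspanP.
Qed.

(** A common criterion for mapping out of the tensor square, applied below to the bracket of g and
    to [wedge]. Antisymmetry turns both action relations into [B_leibniz]. *)
Lemma tsq_rel_eval (k : lieAlgType K) (B : g -> g -> k)
    (Bl : forall a x y z, B (a *: x + y) z = a *: B x z + B y z)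
    (Br : forall a x y z, B x (a *: y + z) = a *: B x y + B x z)
    (B_anti : forall x y, B x y = - B y x)
    (B_leibniz : forall x y z, B x [lie y, z] = B [lie x, y] z - B [lie x, z] y)
    (B_bracket : forall x y x' y',
      [lie B x y, B x' y'] = B [lie x, y] [lie x', y']) s t :
  tsq_rel s t ->
  lt_eval (fun xy : g * g => B xy.1 xy.2) s
  = lt_eval (fun xy : g * g => B xy.1 xy.2) t.
Proof.
have BN x y : B (- x) y = - B x y.
  exact: linear_opp (fun a x z => Bl a x z y) x.
case=> {s t} /= [a x x' y|a x y y'|x x' y|x y y'|x y x' y'].
- exact: Bl.
- exact: Br.
- by rewrite B_leibniz (B_anti x') opprK subrK.
- by rewrite B_leibniz (lie_anti y') (lie_anti y) !BN opprK addrC.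
by rewrite B_bracket (lie_anti y) BN opprK.
Qed.

Lemma commutator_rel s t : tsq_rel s t ->
  lt_eval (fun xy : g * g => [lie xy.1, xy.2]) s
  = lt_eval (fun xy : g * g => [lie xy.1, xy.2]) t.
Proof.
apply: (@tsq_rel_eval g (@lie_bracket K g)) => //.
- exact: lie_linearl.
- by move=> *; apply: lie_linearr.
- exact: lie_anti.
exact: leibniz_identity.
Qed.

Definition tsq_commutator : {linear tsquare g -> g} := lp_lift commutator_rel.

Lemma tsq_commutatorE x y : tsq_commutator (star x y) = [lie x, y].
Proof. exact: (lp_lift_gen commutator_rel). Qed.

Lemma tsq_commutatorB p q :
  tsq_commutator [lie p, q] = [lie tsq_commutator p, tsq_commutator q].
Proof. exact: (lp_lift_bracket commutator_rel). Qed.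

(** Both sides are bilinear and agree on symbols by [star_bracket]. Hence a bracket depends only on
    the commutators of its entries. *)
Lemma tsq_bracketE p q : [lie p, q] = star (tsq_commutator p) (tsq_commutator q).
Proof.
elim: (star_span p) => [_ [x [y ->]]||a p1 p2 _ E1 _ E2].
- elim: (star_span q) => [_ [x' [y' ->]]||a q1 q2 _ E1 _ E2].
  + by rewrite !tsq_commutatorE star_bracket.
  + by rewrite linear0 lie0r star0r.
  by rewrite linearP lie_linearr star_linearr E1 E2.
- by rewrite linear0 lie_anti lie0r oppr0 star0l.
by rewrite linearP lie_linearl star_linearl E1 E2.
Qed.

Definition star_map : {linear tpower g 2 -> tsquare g} :=
  tens2_lift star_linearl star_linearr.

Lemma star_mapE x y : star_map (tens2 x y) = star x y.
Proof. exact: tens2_liftE. Qed.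

(** On pure tensors this is [tsq_bracketE]. It matches the 2-cycles of the tensor square, where the
    bracket vanishes, with the tensors whose image in g (x) g is killed by [star_map]. *)
Lemma star_map_commutator (t : tpower (tsquare g) 2) :
  star_map (tmap tsq_commutator 2 t) = bracket_map _ t.
Proof.
elim: (tens_span t) => [_ [x ->]||a v w _ Ev _ Ew]; rewrite ?linear0 //.
  by rewrite tmapE !tens2E star_mapE bracket_mapE !ffunE tsq_bracketE.
by rewrite !linearP Ev Ew.
Qed.

(** Up to anticommutativity, the three terms of d_3 form the relation [star_actr]. *)
Lemma star_map_d3 (t : tpower g 3) : star_map (leibniz_d g 3 t) = 0.
Proof.
elim: (tens_span t) => [_ [x ->]||a u v _ Eu _ Ev]; rewrite ?linear0 //.
  rewrite leibniz_d3E !linearB !star_mapE star_actr.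
  rewrite (lie_anti (x ord_max)) (lie_anti (x 1)) !starN !opprK.
  by rewrite opprD opprK addrC addrA subrK subrr.
by rewrite !linearP Eu Ev scaler0 addr0.
Qed.
End TensorSquareTheory.

(** * The exterior square modulo boundaries, as a Lie algebra *)

Section ExteriorModel.
Variables (K : fieldType) (g : lieAlgType K).

(** The quotient is the exterior square modulo Chevalley-Eilenberg boundaries, presented in one step
    from tensors. *)
Definition wedge_rel (t : tpower g 2) : Prop :=
  (exists a : tpower g 3, t = leibniz_d g 3 a) \/ ext_rel t.

Definition wedge_quot : Type := lquot wedge_rel.
HB.instance Definition _ := GRing.Lmodule.on wedge_quot.

Definition wedge_pi : {linear tpower g 2 -> wedge_quot} := lquot_pi wedge_rel.

Definition wedge (x y : g) : wedge_quot := wedge_pi (tens2 x y).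

Lemma wedge_linearl a x y z : wedge (a *: x + y) z = a *: wedge x z + wedge y z.
Proof. by rewrite /wedge tens2_linearl linearP. Qed.

Lemma wedge_linearr a x y z : wedge x (a *: y + z) = a *: wedge x y + wedge x z.
Proof. by rewrite /wedge tens2_linearr linearP. Qed.

Lemma wedge_alt x : wedge x x = 0.
Proof. by apply/lquot_pi_eq0/lspan_gen; right; apply/ext_rel2P; exists x. Qed.

Lemma wedge_anti x y : wedge x y = - wedge y x.
Proof.
apply/eqP; rewrite -addr_eq0; have := wedge_alt (1 *: x + y).
by rewrite wedge_linearl !wedge_linearr !scale1r !wedge_alt add0r addr0 => ->.
Qed.

Lemma wedge_leibniz x y z :
  wedge x [lie y, z] = wedge [lie x, y] z - wedge [lie x, z] y.
Proof.
have : wedge_pi (leibniz_d g 3 (tens (triple x y z))) = 0.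
  by apply/lquot_pi_eq0/lspan_gen; left; exists (tens (triple x y z)).
by rewrite leibniz_d_triple !linearB => /eqP; rewrite subr_eq0 => /eqP.
Qed.

Lemma wedge_commutator_rel t : wedge_rel t -> bracket_map g t = 0.
Proof.
case=> [[a ->]|/ext_rel2P[v ->]]; first exact: bracket_map_d3.
by rewrite bracket_mapE lie_alt.
Qed.

Definition wedge_commutator : {linear wedge_quot -> g} :=
  lquot_lift wedge_commutator_rel.

Lemma wedge_commutatorE x y : wedge_commutator (wedge x y) = [lie x, y].
Proof.
by rewrite [LHS](lquot_liftE wedge_commutator_rel) bracket_mapE.
Qed.

(** The formula imitates [tsq_bracketE], so that symbols x * y can be sent to [wedge x y] compatibly
    with brackets. *)
Definition wedge_bracket (m n : wedge_quot) : wedge_quot :=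
  wedge (wedge_commutator m) (wedge_commutator n).

Lemma wedge_bracket_linearl a (m n p : wedge_quot) :
  wedge_bracket (a *: m + n) p = a *: wedge_bracket m p + wedge_bracket n p.
Proof. by rewrite /wedge_bracket linearP wedge_linearl. Qed.

Lemma wedge_bracket_linearr a (m n p : wedge_quot) :
  wedge_bracket m (a *: n + p) = a *: wedge_bracket m n + wedge_bracket m p.
Proof. by rewrite /wedge_bracket linearP wedge_linearr. Qed.

Lemma wedge_bracket_leibniz (m n p : wedge_quot) :
  wedge_bracket m (wedge_bracket n p)
  = wedge_bracket (wedge_bracket m n) p - wedge_bracket (wedge_bracket m p) n.
Proof. by rewrite /wedge_bracket !wedge_commutatorE wedge_leibniz. Qed.

Lemma wedge_bracket_alt m : wedge_bracket m m = 0.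
Proof. exact: wedge_alt. Qed.

HB.instance Definition _ := Lmodule_isLeibniz.Build K wedge_quot
  wedge_bracket_linearl wedge_bracket_linearr wedge_bracket_leibniz.
HB.instance Definition _ := Leibniz_isLie.Build K wedge_quot wedge_bracket_alt.

Lemma wedge_star_rel s t : tsq_rel s t ->
  lt_eval (fun xy : g * g => wedge xy.1 xy.2) s
  = lt_eval (fun xy : g * g => wedge xy.1 xy.2) t.
Proof.
apply: tsq_rel_eval.
- exact: wedge_linearl.
- by move=> *; apply: wedge_linearr.
- exact: wedge_anti.
- exact: wedge_leibniz.
move=> x y x' y'; change (wedge_bracket (wedge x y) (wedge x' y')
  = wedge [lie x, y] [lie x', y']).
by rewrite /wedge_bracket !wedge_commutatorE.
Qed.

Definition tsq_wedge : {linear tsquare g -> wedge_quot} := lp_lift wedge_star_rel.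

(** The quotient map factors through [star_map], so whatever [star_map] kills is a combination of
    boundaries and squares. *)
Lemma tsq_wedgeE (t : tpower g 2) : tsq_wedge (star_map g t) = wedge_pi t.
Proof.
elim: (tens_span t) => [_ [x ->]||a v w _ Ev _ Ew]; rewrite ?linear0 //.
  rewrite tens2E star_mapE; exact: (lp_lift_gen wedge_star_rel).
by rewrite !linearP Ev Ew.
Qed.

Lemma wedge_pi_eq0 (t : tpower g 2) :
  wedge_pi t = 0 -> exists a, CL_CE g 2 t = ce_d g 3 a.
Proof.
move/lquot_pi_eq0; elim=> [v [[a ->]|ev]||c v w _ [a va] _ [b wb]].
- by exists (CL_CE g 3 a); rewrite ce_dE.
- by exists 0; rewrite linear0; apply/lquot_pi_eq0/lspan_gen.
- by exists 0; rewrite !linear0.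
by exists (c *: a + b); rewrite !linearP va wb.
Qed.
End ExteriorModel.

(** * The cokernel of d_3 *)

Section TensorCokernel.
Variables (K : fieldType).

(** HL_2 is the subspace of this cokernel on which the bracket vanishes; here pure tensors can be
    handled without a cycle condition. *)
Definition tensor_coker (k : leibnizAlgType K) : lmodType K :=
  lquot (fun t : tpower k 2 => exists a : tpower k 3, t = leibniz_d k 3 a).

Definition coker_pi (k : leibnizAlgType K) : {linear tpower k 2 -> tensor_coker k} :=
  lquot_pi (fun t : tpower k 2 => exists a : tpower k 3, t = leibniz_d k 3 a).

Lemma coker_pi_d3 (k : leibnizAlgType K) a : coker_pi k (leibniz_d k 3 a) = 0.
Proof. by apply/lquot_pi_eq0/lspan_gen; exists a. Qed.

Lemma coker_pi_eq0 (k : leibnizAlgType K) t :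
  coker_pi k t = 0 -> exists a, t = leibniz_d k 3 a.
Proof. by move/lquot_pi_eq0/lspan_image. Qed.

Lemma coker_leibniz (k : leibnizAlgType K) (x y z : k) :
  coker_pi k (tens2 x [lie y, z])
  = coker_pi k (tens2 [lie x, y] z) - coker_pi k (tens2 [lie x, z] y).
Proof.
have := coker_pi_d3 (tens (triple x y z)).
by rewrite leibniz_d_triple !linearB => /eqP; rewrite subr_eq0 => /eqP.
Qed.
End TensorCokernel.

(** * The perfect case: injectivity and exactness *)

Section PerfectLie.
Variables (K : fieldType) (g : lieAlgType K).
Hypothesis g_perfect : perfect g.

Local Notation h := (tsquare g).
Local Notation u := (tsq_commutator g).

Lemma tsq_commutator_surj (x : g) : exists p, u p = x.
Proof.
elim: (g_perfect x) => [_ [y [z ->]]||a _ _ _ [p <-] _ [q <-]].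
- by exists (star y z); rewrite tsq_commutatorE.
- by exists 0; rewrite linear0.
by exists (a *: p + q); rewrite linearP.
Qed.

(* If u p = x then x * x = [p, p]. *)
Lemma star_alt (x : g) : star x x = 0.
Proof. by have [p <-] := tsq_commutator_surj x; rewrite -tsq_bracketE lie_alt. Qed.

Lemma star_map_ext (t : tpower g 2) : CL_CE g 2 t = 0 -> star_map g t = 0.
Proof.
move/lquot_pi_eq0; apply: lspan_vanish => v /ext_rel2P[x ->].
by rewrite star_mapE star_alt.
Qed.

(** A symbol x * y is the bracket of any lifts of x and y along u. *)
Lemma tsquare_perfect : perfect h.
Proof.
move=> p; apply: lspan_incl (star_span p) => _ [x [y ->]].
have [q <-] := tsq_commutator_surj x; have [r <-] := tsq_commutator_surj y.
by exists q, r; rewrite tsq_bracketE.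
Qed.

(* A central tensor factor is killed by d_3, once the other factor is written
   as a sum of brackets. *)
Lemma coker_centralr (z p : h) : u z = 0 -> coker_pi h (tens2 p z) = 0.
Proof.
move=> z0; have zB q : [lie q, z] = 0 by rewrite tsq_bracketE z0 star0r.
elim: (tsquare_perfect p) => [_ [a [b ->]]||c p1 p2 _ E1 _ E2].
- have := coker_leibniz a b z; rewrite !zB => /eqP.
  rewrite (linear_at0 (fun c => tens2_linearr c a)).
  rewrite (linear_at0 (fun c v w => tens2_linearl c v w b)) linear0 subr0.
  by rewrite eq_sym => /eqP.
- by rewrite (linear_at0 (fun c v w => tens2_linearl c v w z)) linear0.
by rewrite tens2_linearl linearP E1 E2 scaler0 addr0.
Qed.

Lemma coker_centrall (z p : h) : u z = 0 -> coker_pi h (tens2 z p) = 0.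
Proof.
move=> z0; have zB q : [lie z, q] = 0 by rewrite tsq_bracketE z0 star0l.
elim: (tsquare_perfect p) => [_ [a [b ->]]||c p1 p2 _ E1 _ E2].
- rewrite coker_leibniz !zB.
  rewrite !(linear_at0 (fun c v w => tens2_linearl c v w _)).
  by rewrite linear0 subr0.
- by rewrite (linear_at0 (fun c => tens2_linearr c z)) linear0.
by rewrite tens2_linearr linearP E1 E2 scaler0 addr0.
Qed.

Lemma coker_eq (p p' q q' : h) : u p = u p' -> u q = u q' ->
  coker_pi h (tens2 p q) = coker_pi h (tens2 p' q').
Proof.
move=> pE qE.
have p0 : u (p - p') = 0 by rewrite linearB pE subrr.
have q0 : u (q - q') = 0 by rewrite linearB qE subrr.
(* After bilinear expansion, every term but the last has a factor in the kernel of u. *)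
have <- : 1 *: (p - p') + p' = p by rewrite scale1r subrK.
have <- : 1 *: (q - q') + q' = q by rewrite scale1r subrK.
rewrite tens2_linearl !tens2_linearr !linearP.
by rewrite !(coker_centralr _ q0) (coker_centrall _ p0) !linear0 !add0r.
Qed.

Lemma coker_section : exists psi : {linear tpower g 2 -> tensor_coker h},
  forall p q : h, psi (tens2 (u p) (u q)) = coker_pi h (tens2 p q).
Proof.
(* The section s is merely a function; [coker_eq] makes its failure to be linear invisible in the
   cokernel. *)
have [s sK] := boolp.choice tsq_commutator_surj.
have sl a x y z : coker_pi h (tens2 (s (a *: x + y)) (s z))
    = a *: coker_pi h (tens2 (s x) (s z)) + coker_pi h (tens2 (s y) (s z)).
  by rewrite -linearP -tens2_linearl; apply: coker_eq; rewrite ?linearP !sK.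
have sr a z x y : coker_pi h (tens2 (s z) (s (a *: x + y)))
    = a *: coker_pi h (tens2 (s z) (s x)) + coker_pi h (tens2 (s z) (s y)).
  by rewrite -linearP -tens2_linearr; apply: coker_eq; rewrite ?linearP !sK.
exists (tens2_lift sl sr) => p q; rewrite tens2_liftE.
by apply: coker_eq; rewrite !sK.
Qed.

Lemma d3_of_tmap (t : tpower h 2) (a : tpower g 3) :
  tmap u 2 t = leibniz_d g 3 a -> exists b, t = leibniz_d h 3 b.
Proof.
move=> ta; apply: coker_pi_eq0; have [psi psiE] := coker_section.
have psi_tmap s : psi (tmap u 2 s) = coker_pi h s.
  elim: (tens_span s) => [_ [x ->]||c v w _ Ev _ Ew]; rewrite ?linear0 //.
    by rewrite tmapE !tens2E !ffunE psiE.
  by rewrite !linearP Ev Ew.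
(* Lifting a to b makes d_3 a the image of d_3 b, which psi sends to the class of d_3 b, that is to
   0. *)
have [b bE] := tmap_surj (n := 3) tsq_commutator_surj a.
rewrite -psi_tmap ta -bE -(leibniz_d_tmap (@tsq_commutatorB K g)).
by rewrite psi_tmap coker_pi_d3.
Qed.

Lemma HL_HCE_eq0 (z : cycles (leibniz_d g 2)) :
  HL_HCE g 2 (cycle_class (leibniz_d g 3) (leibniz_d g 2) z) = 0
  <-> star_map g (val z) = 0.
Proof.
rewrite [X in X = 0 <-> _]homology_map_class; split.
  move/cycle_class_eq0 => [b zb].
  (* A tensor lift of b corrects z by a Leibniz boundary to a combination of squares, which
     [star_map] kills as g is perfect. *)
  have [a aE] : exists a, CL_CE g 3 a = b.
    by exists (generic_quotient.repr b); apply: lquot_reprK.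
  have : CL_CE g 2 (val z - leibniz_d g 3 a) = 0.
    by rewrite linearB -(ce_dE a) aE -zb subrr.
  by move/star_map_ext; rewrite linearB star_map_d3 subr0.
move=> z0; apply/cycle_class_eq0/wedge_pi_eq0.
by rewrite -tsq_wedgeE z0 linear0.
Qed.

(** Any tensor representing an exterior 2-cycle is itself a Leibniz cycle, because the projection is
    injective in degree one. *)
Lemma HL_HCE_surj (y : HCE g 2) : exists z, HL_HCE g 2 z = y.
Proof.
have [c <-] := cycle_classP y.
pose t : tpower g 2 := generic_quotient.repr (val c).
have tE : CL_CE g 2 t = val c by apply: lquot_reprK.
have dt : leibniz_d g 2 t = 0.
  by apply: tens_ext1_inj; apply: etrans (esym (ce_dE t)) _; rewrite tE cycle_d.
exists (cycle_class (leibniz_d g 3) (leibniz_d g 2) (cycle_of dt)).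
rewrite [LHS]homology_map_class; congr (cycle_class _ _ _).
exact: val_inj.
Qed.

Definition HL_commutator : {linear HL h 2 -> HL g 2} :=
  HL_map (@tsq_commutatorB K g) 2.

Lemma HL_commutator_inj : injective HL_commutator.
Proof.
move=> w w' /eqP; rewrite -subr_eq0 -linearB => /eqP E; apply/eqP.
rewrite -subr_eq0; apply/eqP; move: (w - w') E => {w w'} w.
have [z <-] := cycle_classP w.
rewrite [LHS]homology_map_class => /cycle_class_eq0[a za].
exact/cycle_class_eq0/(d3_of_tmap za).
Qed.

Lemma HL_commutator_image (z : HL g 2) :
  HL_HCE g 2 z = 0 <-> exists w, HL_commutator w = z.
Proof.
split=> [|[w <-]].
  have [c <-] := cycle_classP z; move/HL_HCE_eq0 => c0.
  have [t tE] := tmap_surj (n := 2) tsq_commutator_surj (val c).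
  (* The bracket of the lift t is the value of [star_map] at c, which is 0. *)
  have dt : leibniz_d h 2 t = 0.
    by apply/leibniz_d2_eq0; rewrite -star_map_commutator tE.
  exists (cycle_class (leibniz_d h 3) (leibniz_d h 2) (cycle_of dt)).
  rewrite [LHS]homology_map_class; congr (cycle_class _ _ _).
  exact: val_inj.
have [c <-] := cycle_classP w; rewrite [HL_commutator _]homology_map_class.
apply/HL_HCE_eq0; apply: etrans (star_map_commutator (val c)) _.
exact/leibniz_d2_eq0/cycle_d.
Qed.
End PerfectLie.

Theorem proposition6p2 (K : fieldType) (g : lieAlgType K) (g_perfect : perfect g) :
  exists iota : {linear HL (tsquare g) 2 -> HL g 2},
    [/\ injective iota,
        (forall z : HL g 2, HL_HCE g 2 z = 0 <-> exists w, iota w = z)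
      & (forall y : HCE g 2, exists z : HL g 2, HL_HCE g 2 z = y)].
Proof.
exists (HL_commutator g); split.
- exact: HL_commutator_inj.
- exact: HL_commutator_image.
exact: HL_HCE_surj.
Qed.
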